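(* (Non-propagating IKKT solution $\mathbb{R}^4\times S^3\times S^1$.) Let $(U_i,X^i)$, $i=1,2,3$, be three mutually commuting fuzzy cylinders with radii $R_i>0$ and the same NC modulus $\xi\in\mathbb{R}$. Write $U_1=X^4+iX^5$, $U_2=X^6+iX^7$, $U_3=X^8+iX^9$ with $X^4,\dots,X^9$ Hermitian, and set $$\tilde Z^1=X^4+iX^6,\qquad \tilde Z^2=X^5+iX^7,\qquad \tilde Z^3=X^8+iX^9 .$$ Let $(U_0,X^0)$ be a fuzzy cylinder with radius $1$ and NC modulus $\xi_0$ which commutes with the three cylinders $(U_i,X^i)$. Define ten Hermitian matrices ${X^0}',\dots,{X^9}'$ by $${X^0}'=X^0,\qquad {X^i}'=X^i\ (i=1,2,3),$$ $${X^4}'+i{X^5}'=\tilde Z^1U_0,\qquad {X^6}'+i{X^7}'=\tilde Z^2U_0,\qquad {X^8}'+i{X^9}'=\tilde Z^3U_0 .$$ If $\xi_0=\xi$, then these matrices solve the IKKT equations of motion $$\sum_{b,c=0}^{9}\eta_{bc}[{X^b}',[{X^c}',{X^a}']]=0\qquad\text{for all }a=0,\dots,9.$$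
   Context: Conventions: $\eta=\mathrm{diag}(-1,1,\dots,1)$ on indices $0,\dots,9$. ''Matrices'' are operators on a separable Hilbert space; when they are unbounded, commutators and all identities are understood algebraically on a common invariant dense domain, so everything may be read as taking place in a unital complex $*$-algebra with involution $\dagger$. For a matrix $Z$ written as $Z=A+iB$ with $A,B$ Hermitian, $A=\tfrac12(Z+Z^\dagger)$ and $B=\tfrac1{2i}(Z-Z^\dagger)$. Fuzzy cylinder: a pair $(U,X)$ with $X=X^\dagger$ is a fuzzy cylinder with radius $R>0$ and NC modulus $\xi\in\mathbb{R}$ if $UU^\dagger=U^\dagger U=R^2\mathbf 1$, $[U,X]=\xi U$ and $[U^\dagger,X]=-\xi U^\dagger$. Two cylinders commute if every element of $\{U,U^\dagger,X\}$ of the first commutes with every such element of the second. *)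

(* Defs.v *)
From HB Require Import structures.
From mathcomp Require Import all_boot all_order all_algebra.
From mathcomp Require Import reals complex.

Set Implicit Arguments.
Unset Strict Implicit.
Unset Printing Implicit Defensive.

Import Order.TTheory GRing.Theory Num.Theory.

Local Open Scope complex_scope.
Local Open Scope ring_scope.

HB.mixin Record Algebra_isStar (R : rcfType) A of GRing.Algebra R[i] A := {
  dagger : A -> A;
  daggerK : involutive dagger;
  daggerD : {morph dagger : x y / x + y};
  daggerZ : forall (c : R[i]) (x : A), dagger (c *: x) = c^* *: dagger x;
  daggerM : forall x y : A, dagger (x * y) = dagger y * dagger x
}.

(* Unital complex *-algebras: no norm and no completeness, since unbounded
   operators on a common invariant dense domain are to be covered. *)
#[short(type="starAlgType")]
HB.structure Definition StarAlgebra (R : rcfType) :=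
  { A of GRing.Algebra R[i] A & Algebra_isStar R A }.

Notation "x ^dag" := (dagger x) (at level 2, left associativity) : ring_scope.

Definition is_hermitian (R : rcfType) (A : starAlgType R) (x : A) : Prop :=
  x^dag = x.

Definition commutator (A : pzRingType) (x y : A) : A := x * y - y * x.

Notation "[c x , y ]" := (commutator x y)
  (at level 0, x, y at level 99, format "[c  x ,  y ]") : ring_scope.

Section Cylinders.
Variables (R : rcfType) (A : starAlgType R).

Record fuzzy_cylinder (r xi : R) (U X : A) : Prop := FuzzyCylinder {
  cyl_herm : is_hermitian X;
  cyl_radius : 0 < r;
  cyl_UUdag : U * U^dag = (r ^+ 2)%:C *: 1;
  cyl_UdagU : U^dag * U = (r ^+ 2)%:C *: 1;
  cyl_comm : [c U, X] = xi%:C *: U;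
  cyl_comm_dag : [c U^dag, X] = - xi%:C *: U^dag
}.

Definition cylinders_commute (U X V Y : A) : Prop :=
  forall a b : A, a \in [:: U; U^dag; X] -> b \in [:: V; V^dag; Y] ->
  a * b = b * a.

Definition eta : 'M[R[i]]_10 :=
  diag_mx (\row_(b < 10) if b == ord0 then -1 else 1).

Definition IKKT_eom (X : 10.-tuple A) : Prop :=
  forall a : 'I_10,
    \sum_(b < 10) \sum_(c < 10)
      eta b c *: [c tnth X b, [c tnth X c, tnth X a]] = 0.

(* Every Z is uniquely of the form P + iQ with P, Q Hermitian, so such P and Q
   may be introduced by these three conditions. *)
Lemma hermitian_partsP (Z P Q : A) :
  [/\ is_hermitian P, is_hermitian Q & Z = P + 'i *: Q] <->
  P = 2^-1 *: (Z + Z^dag) /\ Q = (2 * 'i)^-1 *: (Z - Z^dag).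
Proof.
have n2 : (2 : R[i]) != 0 by rewrite pnatr_eq0.
have ni : ('i : R[i]) != 0 by rewrite neq0Ci.
have c2 : (2^-1 : R[i])^* = 2^-1 by rewrite fmorphV rmorph_nat.
have ci2 (C : numClosedFieldType) : ((2 * 'i)^-1 : C)^* = - (2 * 'i)^-1.
  by rewrite fmorphV rmorphM /= rmorph_nat conjCi mulrN invrN.
have dN x : (- x : A)^dag = - x^dag.
  by rewrite -scaleN1r daggerZ rmorphN rmorph1 scaleN1r.
have dbl (x : A) : x + x = (2 : R[i]) *: x by rewrite scaler_nat mulr2n.
split.
  case=> hP hQ ->; rewrite daggerD daggerZ hP hQ conjCi scaleNr.
  split.
    by rewrite addrACA subrr addr0 dbl scalerA mulVf // scale1r.
  rewrite opprD opprK addrACA subrr add0r dbl !scalerA.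
  have n2i : (2 * 'i : R[i]) != 0 by apply/mulf_neq0.
  by rewrite -mulrA mulVf ?scale1r.
case=> -> ->; split.
- by rewrite /is_hermitian daggerZ daggerD daggerK c2 addrC.
- by rewrite /is_hermitian daggerZ daggerD dN daggerK ci2 scaleNr -scalerN opprB.
rewrite scalerA invfM mulrCA mulfV // mulr1 -scalerDr addrACA subrr addr0.
by rewrite dbl scalerA mulVf // scale1r.
Qed.

End Cylinders.

(* Main.v *)
(** Think of the U_i as plane waves: [U_i] and [U_i^dag] are simultaneous
    eigenvectors of all the derivations [[c -, X_j]], with momentum [+- xi e_i],
    and eigenvalues add under multiplication.  Hence [U_i * U_0] and
    [U_i^dag * U_0], i = 1, 2, 3, have momentum [+- xi e_i + xi e_0], which is
    null for the Minkowski metric when xi_0 = xi, so they are annihilated by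
    the d'Alembertian of X_0, ..., X_3; so are X_4', ..., X_9', which are linear
    combinations of these products and their adjoints.  All remaining terms of
    the equations of motion vanish because the U's and their adjoints generate
    a commutative algebra that is stable under the derivations. *)

Require Import Defs.
From mathcomp Require Import all_boot all_order all_algebra.
From mathcomp Require Import reals complex.

Import Order.TTheory GRing.Theory Num.Theory.
Local Open Scope complex_scope.
Local Open Scope ring_scope.


Set Implicit Arguments.
Unset Strict Implicit.
Unset Printing Implicit Defensive.

(** * Commutator calculus and generated subalgebras *)

Section CommutatorTheory.
Variables (R : rcfType) (A : starAlgType R).
Implicit Types (x y z : A) (c : R[i]).

Lemma commutator_eq0 x y : x * y = y * x -> [c x, y] = 0.
Proof. by rewrite /commutator => ->; rewrite subrr. Qed.

Lemma commutatorC x y : [c x, y] = - [c y, x].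
Proof. by rewrite /commutator opprB. Qed.

Lemma commutatorDl x y z : [c x + y, z] = [c x, z] + [c y, z].
Proof. by rewrite /commutator mulrDl mulrDr opprD addrACA. Qed.

Lemma commutatorDr z x y : [c z, x + y] = [c z, x] + [c z, y].
Proof. by rewrite /commutator mulrDl mulrDr opprD addrACA. Qed.

Lemma commutatorZl c x y : [c c *: x, y] = c *: [c x, y].
Proof. by rewrite /commutator -scalerAl -scalerAr scalerBr. Qed.

Lemma commutatorZr c x y : [c y, c *: x] = c *: [c y, x].
Proof. by rewrite /commutator -scalerAl -scalerAr scalerBr. Qed.

Lemma commutatorNr x y : [c y, - x] = - [c y, x].
Proof. by rewrite -scaleN1r commutatorZr scaleN1r. Qed.

Lemma commutatorMl x y z : [c x * y, z] = x * [c y, z] + [c x, z] * y.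
Proof. by rewrite /commutator mulrBr mulrBl !mulrA addrA subrK. Qed.

Lemma daggerN x : (- x)^dag = - x^dag.
Proof. by rewrite -scaleN1r daggerZ rmorphN rmorph1 scaleN1r. Qed.

Lemma dagger0 : (0 : A)^dag = 0.
Proof. by have := daggerZ 0 (0 : A); rewrite rmorph0 !scale0r. Qed.

Lemma dagger_sum (I : finType) (F : I -> A) :
  (\sum_i F i)^dag = \sum_i (F i)^dag.
Proof. exact: (big_morph (fun x : A => x^dag) (@daggerD R A) dagger0). Qed.

Lemma dagger_commutator x y : [c x, y]^dag = - [c x^dag, y^dag].
Proof. by rewrite /commutator daggerD daggerN !daggerM opprB. Qed.

Lemma cylinders_commute_sym (U X V Y : A) :
  cylinders_commute U X V Y -> cylinders_commute V Y U X.
Proof. by move=> h a b ha hb; rewrite (h b a). Qed.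

(** Inductive, so that commutation, stability under a derivation and stability under the adjoint
    need checking on generators only. *)
Inductive gen_subalg (S : A -> Prop) : A -> Prop :=
| gen_base x of S x : gen_subalg S x
| gen_add x y of gen_subalg S x & gen_subalg S y : gen_subalg S (x + y)
| gen_scale c x of gen_subalg S x : gen_subalg S (c *: x)
| gen_mul x y of gen_subalg S x & gen_subalg S y : gen_subalg S (x * y).

Lemma gen_subalg_commr (S : A -> Prop) z :
  (forall x, S x -> x * z = z * x) ->
  forall x, gen_subalg S x -> x * z = z * x.
Proof.
move=> Sz x; elim=> {x} [//|x y _ hx _ hy|c x _ hx|x y _ hx _ hy].
- by rewrite mulrDl mulrDr hx hy.
- by rewrite -scalerAl -scalerAr hx.
- by rewrite -mulrA hy mulrA hx mulrA.
Qed.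

(** Centralizers are subalgebras; this is used once for each of the two factors. *)
Lemma gen_subalg_comm (S : A -> Prop) :
  (forall x y, S x -> S y -> x * y = y * x) ->
  forall x y, gen_subalg S x -> gen_subalg S y -> x * y = y * x.
Proof.
move=> SS x y gx gy; apply: gen_subalg_commr gx => z Sz.
by apply/esym; apply: gen_subalg_commr gy => w Sw; apply: SS.
Qed.

(** The map [[c -, z]] is a derivation, so the Leibniz rule carries stability from generators to
    products. *)
Lemma gen_subalg_commutator (S : A -> Prop) z :
  (forall x, S x -> gen_subalg S [c x, z]) ->
  forall x, gen_subalg S x -> gen_subalg S [c x, z].
Proof.
move=> Sz x; elim=> {x} [//|x y _ hx _ hy|c x _ hx|x y gx hx gy hy].
- by rewrite commutatorDl; apply: gen_add.
- by rewrite commutatorZl; apply: gen_scale.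
- by rewrite commutatorMl; apply: gen_add; apply: gen_mul.
Qed.

Lemma gen_subalg_dagger (S : A -> Prop) :
  (forall x, S x -> S x^dag) ->
  forall x, gen_subalg S x -> gen_subalg S x^dag.
Proof.
move=> Sd x; elim=> {x} [x Sx|x y _ hx _ hy|c x _ hx|x y _ hx _ hy].
- exact/gen_base/Sd.
- by rewrite daggerD; apply: gen_add.
- by rewrite daggerZ; apply: gen_scale.
- by rewrite daggerM; apply: gen_mul.
Qed.

End CommutatorTheory.

(** * The d'Alembertian and its simultaneous eigenvectors *)

Section Box.
Variables (R : rcfType) (A : starAlgType R) (n : nat).
Variables (e : 'I_n -> R[i]) (X : 'I_n -> A).
Implicit Types (x y w v : A) (k l : 'I_n -> R[i]).

Definition box x : A := \sum_j e j *: [c X j, [c X j, x]].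

Lemma boxD x y : box (x + y) = box x + box y.
Proof.
by rewrite -big_split; apply: eq_bigr => j _; rewrite !commutatorDr scalerDr.
Qed.

Lemma boxZ (c : R[i]) x : box (c *: x) = c *: box x.
Proof.
rewrite scaler_sumr; apply: eq_bigr => j _.
by rewrite !commutatorZr !scalerA mulrC.
Qed.

(** The adjoint of a commutator brings a minus sign, and the two nested commutators cancel
    theirs. *)
Lemma box_dagger x : (forall j, (e j)^* = e j) ->
  (forall j, is_hermitian (X j)) -> box x^dag = (box x)^dag.
Proof.
move=> he hX; rewrite dagger_sum; apply: eq_bigr => j _.
rewrite daggerZ he !dagger_commutator hX.
by rewrite commutatorNr opprK.
Qed.

Definition has_weight k w := forall j, [c w, X j] = k j *: w.

Lemma has_weightM k l w v : has_weight k w -> has_weight l v ->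
  has_weight (fun j => k j + l j) (w * v).
Proof.
move=> hw hv j; rewrite commutatorMl hw hv -scalerAl -scalerAr -scalerDl.
by rewrite addrC.
Qed.

(** Both commutators in [box] have [X j] on the left and so act by [- k j]; the signs cancel in the
    square. *)
Lemma box_weight k w : has_weight k w ->
  box w = (\sum_j e j * k j ^+ 2) *: w.
Proof.
move=> hw; rewrite scaler_suml; apply: eq_bigr => j _; rewrite expr2.
have hX : [c X j, w] = - (k j *: w) by rewrite commutatorC hw.
by rewrite hX commutatorNr commutatorZr hX !scalerN opprK !scalerA -mulrA.
Qed.

End Box.

(** * Commuting cylinders with a common modulus *)

Section CylinderFamily.
Variables (R : rcfType) (A : starAlgType R) (n : nat).
Variables (r : 'I_n -> R) (xi : R) (U X : 'I_n -> A).
Hypothesis cylU : forall i, fuzzy_cylinder (r i) xi (U i) (X i).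
Hypothesis commU :
  forall i j, i != j -> cylinders_commute (U i) (X i) (U j) (X j).

Definition cyl_gen (x : A) : Prop := exists i, x = U i \/ x = (U i)^dag.

(** The sign [s] is 1 for [U i] and -1 for its adjoint. *)
Definition momentum (s : R[i]) (i j : 'I_n) : R[i] := s * xi%:C * (j == i)%:R.

Lemma weight_U i : has_weight X (momentum 1 i) (U i).
Proof.
move=> j; rewrite /momentum; have [->|ne] := eqVneq j i.
  by rewrite mul1r mulr1 (cyl_comm (cylU i)).
rewrite mulr0 scale0r; apply: commutator_eq0.
by apply: (commU (i := i) (j := j)); rewrite 1?eq_sym // !inE eqxx ?orbT.
Qed.

Lemma weight_Udag i : has_weight X (momentum (-1) i) (U i)^dag.
Proof.
move=> j; rewrite /momentum; have [->|ne] := eqVneq j i.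
  by rewrite mulN1r mulr1 (cyl_comm_dag (cylU i)).
rewrite mulr0 scale0r; apply: commutator_eq0.
by apply: (commU (i := i) (j := j)); rewrite 1?eq_sym // !inE eqxx ?orbT.
Qed.

Lemma cyl_commX i j : [c X i, X j] = 0.
Proof.
apply: commutator_eq0; have [->//|ne] := eqVneq i j.
by apply: (commU ne); rewrite !inE eqxx ?orbT.
Qed.

(** Within one cylinder this is normality of [U i]; across cylinders it is their mutual
    commutation. *)
Lemma cyl_gen_comm x y : cyl_gen x -> cyl_gen y -> x * y = y * x.
Proof.
have cU i : U i * (U i)^dag = (U i)^dag * U i.
  by rewrite (cyl_UUdag (cylU i)) (cyl_UdagU (cylU i)).
case=> i xE [j yE]; have [eij|ne] := eqVneq i j.
  by move: xE yE; rewrite eij => -[] -> [] ->.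
by apply: (commU ne); rewrite !inE; [case: xE|case: yE] => ->;
  rewrite eqxx ?orbT.
Qed.

Lemma cyl_gen_dagger x : cyl_gen x -> cyl_gen x^dag.
Proof.
case=> i [] ->; exists i; first by right.
by left; rewrite daggerK.
Qed.

Lemma cyl_gen_commutator j x :
  gen_subalg cyl_gen x -> gen_subalg cyl_gen [c x, X j].
Proof.
apply: gen_subalg_commutator => {}x gx.
have gg : gen_subalg cyl_gen x by apply: gen_base.
by case: gx gg => i [] -> gg; rewrite ?weight_U ?weight_Udag; apply: gen_scale.
Qed.

(** The inner commutator stays in the commutative algebra that contains [x]. This removes the
    internal terms from the equations for the first four matrices. *)
Lemma cyl_gen_double_commutator j x :
  gen_subalg cyl_gen x -> [c x, [c x, X j]] = 0.
Proof.
move=> gx; apply/commutator_eq0/(gen_subalg_comm cyl_gen_comm) => //.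
exact: cyl_gen_commutator.
Qed.

End CylinderFamily.

(** * Harmonic elements and their Hermitian parts *)

Section HarmonicAlgebra.
Variables (R : rcfType) (A : starAlgType R) (n : nat).
Variables (e : 'I_n -> R[i]) (X : 'I_n -> A) (S : A -> Prop).
Hypothesis e_real : forall j, (e j)^* = e j.
Hypothesis X_herm : forall j, is_hermitian (X j).
Hypothesis S_dagger : forall x, S x -> S x^dag.

Definition harmonic (x : A) : Prop := gen_subalg S x /\ box e X x = 0.

Lemma harmonicD x y : harmonic x -> harmonic y -> harmonic (x + y).
Proof.
by move=> [gx bx] [gy by_]; split; [apply: gen_add|rewrite boxD bx by_ addr0].
Qed.

Lemma harmonicZ c x : harmonic x -> harmonic (c *: x).
Proof.
by move=> [gx bx]; split; [apply: gen_scale|rewrite boxZ bx scaler0].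
Qed.

Lemma harmonic_dagger x : harmonic x -> harmonic x^dag.
Proof.
move=> [gx bx]; split; first exact: gen_subalg_dagger.
by rewrite box_dagger // bx dagger0.
Qed.

Lemma harmonic_parts P Q Z : is_hermitian P -> is_hermitian Q ->
  P + 'i *: Q = Z -> harmonic Z -> harmonic P /\ harmonic Q.
Proof.
move=> hP hQ ZE hZ; have hZd := harmonic_dagger hZ.
have [|-> ->] := (hermitian_partsP Z P Q).1; first by split.
split; apply/harmonicZ/harmonicD => //.
by rewrite -scaleN1r; apply: harmonicZ.
Qed.

(** Since [U^dag * V] is not the adjoint of [U * V], its harmonicity is a separate hypothesis;
    [P * V] and [Q * V] are linear combinations of the two. *)
Lemma harmonic_partsM P Q U V : is_hermitian P -> is_hermitian Q ->
  U = P + 'i *: Q -> harmonic (U * V) -> harmonic (U^dag * V) ->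
  harmonic (P * V) /\ harmonic (Q * V).
Proof.
move=> hP hQ UE hU hUd.
have [|-> ->] := (hermitian_partsP U P Q).1; first by split.
rewrite -!scalerAl mulrDl mulrBl.
split; apply/harmonicZ/harmonicD => //.
by rewrite -scaleN1r; apply: harmonicZ.
Qed.

End HarmonicAlgebra.

(** * Minkowski signature and null momenta *)

Section Spacetime.
Variables (R : rcfType) (A : starAlgType R).

Definition minkowski (j : 'I_4) : R[i] := if j == ord0 then -1 else 1.

Lemma minkowski_real j : (minkowski j)^* = minkowski j.
Proof.
by rewrite /minkowski; case: ifP; rewrite ?rmorphN rmorph1.
Qed.

Lemma IKKT_eom_cat (T : 4.-tuple A) (Y : 6.-tuple A) :
    (forall i j, [c tnth T i, tnth T j] = 0) ->
    (forall k j, [c tnth Y k, [c tnth Y k, tnth T j]] = 0) ->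
    (forall k l, [c tnth Y k, tnth Y l] = 0) ->
    (forall k, box minkowski (tnth T) (tnth Y k) = 0) ->
  IKKT_eom (cat_tuple T Y).
Proof.
move=> TT YT YY boxY a.
have TYl (j : 'I_4) : tnth (cat_tuple T Y : 10.-tuple A) (lshift 6 j) = tnth T j.
  exact: (tnth_lshift T Y j).
have TYr (j : 'I_6) : tnth (cat_tuple T Y : 10.-tuple A) (rshift 4 j) = tnth Y j.
  exact: (tnth_rshift T Y j).
have cm0 x : [c x, 0] = 0 :> A by apply: commutator_eq0; rewrite mulr0 mul0r.
(* As [eta] is diagonal, only [c = b] survives in the inner sum. *)
under eq_bigr => b _.
  rewrite (bigD1 b) //= big1 => [|c ne]; last first.
    by rewrite !mxE (eq_sym b c) (negbTE ne) mulr0n scale0r.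
  rewrite addr0 !mxE eqxx mulr1n.
  over.
rewrite (@big_split_ord _ _ _ 4 6) /=.
(* For [a] in [T] both blocks vanish termwise; for [a] in [Y] the [T] block is the d'Alembertian of
   [tnth Y k]. *)
case: (@split_ordP 4 6 a) => k ->.
  rewrite !big1 ?addr0 // => j _.
    by rewrite !TYr !TYl YT scaler0.
  by rewrite !TYl TT cm0 scaler0.
rewrite [X in _ + X]big1 ?addr0 => [|j _]; last first.
  by rewrite !TYr YY cm0 scaler0.
rewrite -[RHS](boxY k); apply: eq_bigr => j _.
by rewrite TYl TYr.
Qed.

(** The quadratic form is [- xi ^+ 2 + (s * xi) ^+ 2], which is zero because time and space
    components share the same [xi]. *)
Lemma box_null_momentum (X : 'I_4 -> A) (xi : R) (s : R[i]) i w : s ^+ 2 = 1 ->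
  i != ord0 ->
  has_weight X (fun j => momentum xi s i j + momentum xi 1 ord0 j) w ->
  box minkowski X w = 0.
Proof.
move=> s2 ne0 hw; rewrite (box_weight _ hw) (bigD1 ord0) //= (bigD1 i) //=.
rewrite big1 => [|j /andP[j0 ji]]; last first.
  by rewrite /momentum (negbTE ji) (negbTE j0) !mulr0 addr0 expr0n mulr0.
rewrite /minkowski /momentum !eqxx (negbTE ne0) eq_sym (negbTE ne0) !mulr0 !mulr1.
by rewrite !mul1r add0r !addr0 exprMn s2 mul1r mulN1r addNr scale0r.
Qed.

Lemma harmonic_cylM (r : 'I_4 -> R) (xi : R) (U X : 'I_4 -> A) i :
  (forall i, fuzzy_cylinder (r i) xi (U i) (X i)) ->
  (forall i j, i != j -> cylinders_commute (U i) (X i) (U j) (X j)) ->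
  i != ord0 ->
  harmonic minkowski X (cyl_gen U) (U i * U ord0) /\
  harmonic minkowski X (cyl_gen U) ((U i)^dag * U ord0).
Proof.
move=> cylU commU ne0.
have wU := weight_U cylU commU; have wUd := weight_Udag cylU commU.
have gU k : gen_subalg (cyl_gen U) (U k) by apply: gen_base; exists k; left.
have gUd k : gen_subalg (cyl_gen U) (U k)^dag.
  by apply: gen_base; exists k; right.
split; (split; first exact: gen_mul).
  apply: (box_null_momentum _ ne0 (has_weightM (wU i) (wU ord0))).
  by rewrite expr1n.
apply: (box_null_momentum _ ne0 (has_weightM (wUd i) (wU ord0))).
by rewrite sqrrN expr1n.
Qed.

End Spacetime.

Theorem mainTheorem2 (R : realType) (A : starAlgType R)
    (R1 R2 R3 xi xi0 : R)
    (U0 U1 U2 U3 X0 X1 X2 X3 : A)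
    (X4 X5 X6 X7 X8 X9 : A)
    (X4' X5' X6' X7' X8' X9' : A)
    (cyl1 : fuzzy_cylinder R1 xi U1 X1)
    (cyl2 : fuzzy_cylinder R2 xi U2 X2)
    (cyl3 : fuzzy_cylinder R3 xi U3 X3)
    (comm12 : cylinders_commute U1 X1 U2 X2)
    (comm13 : cylinders_commute U1 X1 U3 X3)
    (comm23 : cylinders_commute U2 X2 U3 X3)
    (hX4 : is_hermitian X4) (hX5 : is_hermitian X5) (hX6 : is_hermitian X6)
    (hX7 : is_hermitian X7) (hX8 : is_hermitian X8) (hX9 : is_hermitian X9)
    (U1E : U1 = X4 + 'i *: X5)
    (U2E : U2 = X6 + 'i *: X7)
    (U3E : U3 = X8 + 'i *: X9)
    (cyl0 : fuzzy_cylinder 1 xi0 U0 X0)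
    (comm01 : cylinders_commute U0 X0 U1 X1)
    (comm02 : cylinders_commute U0 X0 U2 X2)
    (comm03 : cylinders_commute U0 X0 U3 X3)
    (hX4' : is_hermitian X4') (hX5' : is_hermitian X5') (hX6' : is_hermitian X6')
    (hX7' : is_hermitian X7') (hX8' : is_hermitian X8') (hX9' : is_hermitian X9') :
  let Z1 := X4 + 'i *: X6 in
  let Z2 := X5 + 'i *: X7 in
  let Z3 := X8 + 'i *: X9 in
  X4' + 'i *: X5' = Z1 * U0 ->
  X6' + 'i *: X7' = Z2 * U0 ->
  X8' + 'i *: X9' = Z3 * U0 ->
  xi0 = xi ->
  IKKT_eom [tuple X0; X1; X2; X3; X4'; X5'; X6'; X7'; X8'; X9'].
Proof.
(* Equality of the moduli lets [U0] join the other three in one family of four, with index 0 as the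
   time direction. *)
move=> Z1 Z2 Z3 Z1E Z2E Z3E exi; rewrite exi in cyl0.
pose U := tnth [tuple U0; U1; U2; U3]; pose X := tnth [tuple X0; X1; X2; X3].
pose r := tnth [tuple 1; R1; R2; R3].
have cylU i : fuzzy_cylinder (r i) xi (U i) (X i).
  by case: i => -[|[|[|[|]]]].
have commU i j : i != j -> cylinders_commute (U i) (X i) (U j) (X j).
  by case: i j => -[|[|[|[|//]]]] ? [] [|[|[|[|//]]]] ? //= _ //;
    apply: cylinders_commute_sym.
have harm i : i != ord0 -> _ := harmonic_cylM cylU commU.
have X_herm i : is_hermitian (X i) := cyl_herm (cylU i).
have harmP := harmonic_parts (minkowski_real R) X_herm (@cyl_gen_dagger R A 4 U).
pose good := harmonic (minkowski R) X (cyl_gen U).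
have good_parts (k : nat) (k4 : (k < 4)%N) P Q : (0 < k)%N ->
    is_hermitian P -> is_hermitian Q -> U (Ordinal k4) = P + 'i *: Q ->
  good (P * U0) /\ good (Q * U0).
  move=> k0 hP hQ UE; have [|hU hUd] := harm (Ordinal k4).
    by rewrite -val_eqE /= -lt0n.
  exact: harmonic_partsM hP hQ UE hU hUd.
have [g4 g5] := good_parts 1%N isT _ _ isT hX4 hX5 U1E.
have [g6 g7] := good_parts 2%N isT _ _ isT hX6 hX7 U2E.
have [g8 g9] := good_parts 3%N isT _ _ isT hX8 hX9 U3E.
(* [Z1] and [Z2] mix parts of [U1] and [U2], so their products with [U0] are handled by linearity
   from the six harmonic products [X4 * U0] to [X9 * U0]. *)
have goodZ P Q : good (P * U0) -> good (Q * U0) -> good ((P + 'i *: Q) * U0).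
  by move=> gP gQ; rewrite mulrDl -scalerAl; apply/harmonicD/harmonicZ.
have [g4' g5'] := harmP _ _ _ hX4' hX5' Z1E (goodZ _ _ g4 g6).
have [g6' g7'] := harmP _ _ _ hX6' hX7' Z2E (goodZ _ _ g5 g7).
have [g8' g9'] := harmP _ _ _ hX8' hX9' Z3E (goodZ _ _ g8 g9).
pose T := [tuple X0; X1; X2; X3].
pose Y := [tuple X4'; X5'; X6'; X7'; X8'; X9'].
have gY k : good (tnth Y k) by case: k => -[|[|[|[|[|[|]]]]]].
rewrite (_ : [tuple of _] = cat_tuple T Y); last exact: val_inj.
apply: IKKT_eom_cat => [i j|k j|k l|k].
- exact: (cyl_commX commU).
- exact: (cyl_gen_double_commutator cylU commU _ (gY k).1).
- apply/commutator_eq0/(gen_subalg_comm (cyl_gen_comm cylU commU)).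
    exact: (gY k).1.
  exact: (gY l).1.
- exact: (gY k).2.
Qed.
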